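(* If $\mathcal{A}=(A,E_1,\dots,E_n)$ is a countable nested $n$-equivalence structure such that all equivalence classes (of every $E_i$, $1\le i\le n$) are finite, then $\mathcal{A}$ is ultrahomogeneous if and only if each $(A,E_i)$, $1\le i\le n$, is ultrahomogeneous.
   Context: An $n$-equivalence structure ($n<\omega$) is a structure $(A,E_1,\dots,E_n)$ where each $E_i$ is an equivalence relation on $A$; it is nested if $E_j\subseteq E_i$ whenever $i<j\le n$. A structure is ultrahomogeneous if every isomorphism between finitely generated substructures (here, finite subsets with the induced relations) extends to an automorphism of the structure. *)

(* Defs.v *)
From Stdlib Require Import RelationClasses.
From mathcomp Require Import all_boot.
From mathcomp Require Import boolp classical_sets functions cardinality.

Set Implicit Arguments.
Unset Strict Implicit.
Unset Printing Implicit Defensive.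

Local Open Scope classical_set_scope.

(* The relations E_1, ..., E_n are indexed by 'I_n, i.e. from 0 to n - 1. *)
Record eqStructure (n : nat) := EqStructure {
  carrier :> Type;
  erel : 'I_n -> carrier -> carrier -> Prop;
  erel_equiv : forall i, Equivalence (erel i)
}.

Definition nested n (A : eqStructure n) : Prop :=
  forall (i j : 'I_n), (i < j)%N -> forall x y : A, erel j x y -> erel i x y.

Definition eclass n (A : eqStructure n) (i : 'I_n) (x : A) : set A :=
  [set y | erel i x y].

Definition isomorphism n (A B : eqStructure n) (f : A -> B) : Prop :=
  bijective f /\ forall i (x y : A), erel i x y <-> erel i (f x) (f y).

Definition automorphism n (A : eqStructure n) (g : A -> A) : Prop :=
  isomorphism g.

Lemma induced_equiv n (A : eqStructure n) (S : set A) (i : 'I_n) :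
  Equivalence (fun x y : S => erel i (val x) (val y)).
Proof.
case: (erel_equiv A i) => r s t; split=> [x|x y|x y z].
- exact: r.
- exact: s.
- exact: t.
Qed.

Definition induced n (A : eqStructure n) (S : set A) : eqStructure n :=
  EqStructure (induced_equiv S).

Definition reduct n (A : eqStructure n) (i : 'I_n) : eqStructure 1 :=
  EqStructure (fun _ : 'I_1 => erel_equiv A i).

(* The language is relational, so every subset carries a substructure and the
   finitely generated substructures are exactly those on finite subsets. *)
Definition ultrahomogeneous n (A : eqStructure n) : Prop :=
  forall S T : set A, finite_set S -> finite_set T ->
  forall f : induced S -> induced T, isomorphism f ->
  exists2 g : A -> A, automorphism g &
    forall x : S, g (val x) = val (f x : T).

(* Main.v *)
Require Import Defs.
From mathcomp Require Import all_boot.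
From mathcomp Require Import boolp classical_sets functions cardinality.

(** Both sides of the equivalence say the same thing: for each [i], all
classes of [E_i] have the same cardinality.

If a structure is ultrahomogeneous, then the isomorphism [{x} -> {y}] extends
to an automorphism, which carries the [E_i]-class of [x] onto that of [y]
([ultrahomogeneous_card_eclass]).  This applies to the whole structure and to
each of its one-relation reducts.

Conversely, a nested structure with finite classes that is uniform in this
sense is ultrahomogeneous ([uniform_ultrahomogeneous]); a reduct is a nested
structure with one relation, so this covers both directions of the theorem.
Given an isomorphism [f] between finite substructures [S] and [T], the points
of [S] and [T] together with their classes form a finite set [U], and by
nestedness [U] is closed under every [E_i].  It is therefore enough to extend
[f] to an automorphism of [U] and to glue it with the identity outside [U].

Inside [U], put the total relation before [E_1] and equality after [E_n].  The
result is a decreasing chain of equivalence relations, still uniform, and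
preserving all of them includes being injective.  The map is extended one point
[x] at a time ([one_point_extension]).  Let [e_k] be the finest relation of the
chain that relates [x] to some point [a0] of the domain.  The image of [x] has
to be chosen in the [e_k]-class of [f a0], outside every [e_(k+1)]-class of an
image point.  In the [e_k]-class of [x], the [e_(k+1)]-classes that meet the
domain miss [x]; on the image side just as many classes are excluded
([card_classes_meeting]), and all classes have the same size, so a counting
argument leaves a free point.  Once every point of [U] has been added, the map
is injective, hence a permutation since [U] is finite. *)

Local Open Scope classical_set_scope.

(** * Counting *)

Lemma card_eq_pred (F G : finType) (P : pred F) (Q : pred G) :
  ([set` P] #= [set` Q])%card -> #|P| = #|Q|.
Proof.
move=> /card_bijP[f fbij].
have P_in (x : {x | P x}) : val x \in [set` P] by rewrite inE; exact: valP x.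
have Q_in (y : {y | Q y}) : val y \in [set` Q] by rewrite inE; exact: valP y.
have P_of (x : [set` P]) : P (val x) by exact: set_valP x.
have Q_of (y : [set` Q]) : Q (val y) by exact: set_valP y.
rewrite -[LHS](card_sig P) -[RHS](card_sig Q).
have [g fg gf] := fbij.
apply: (@bij_eq_card _ _
  (fun x : {x | P x} => exist Q _ (Q_of (f (SigSub (P_in x)))))).
exists (fun y : {y | Q y} => exist P _ (P_of (g (SigSub (Q_in y)))));
  move=> z; apply: val_inj => /=.
  by rewrite (_ : SigSub _ = f (SigSub (P_in z))) ?fg //; apply: val_inj.
by rewrite (_ : SigSub _ = g (SigSub (Q_in z))) ?gf //; apply: val_inj.
Qed.

Lemma finite_set_enum (T : Type) (U : set T) : finite_set U ->
  exists (N : nat) (h : 'I_N -> T),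
    injective h /\ forall x, U x <-> exists a, h a = x.
Proof.
elim/Pchoice: T => T in U *.
move=> /finite_seqP[s ->].
exists #|{: seq_sub s}|, (fun a => val (enum_val a)); split=> [a b|x].
  by move=> /val_inj/enum_val_inj.
split=> [xs|[a <-]]; last exact: valP.
by exists (enum_rank (SeqSub xs)); rewrite enum_rankK.
Qed.

Lemma equivalence_rel_sym (T : Type) (r : rel T) :
  equivalence_rel r -> symmetric r.
Proof.
move=> /equivalence_relP[r_refl r_left].
suff r_symW x y : r x y -> r y x by move=> x y; apply/idP/idP; apply: r_symW.
by move=> xy; rewrite -(r_left _ _ xy).
Qed.

(** By induction on [s]: a new point either lies in a class already met, and
then the same happens on the image side, or contributes [m] new elements on
both sides.  This compares the two unions without counting classes. *)
Lemma card_classes_meeting (F : finType) (r : rel F) (m : nat) (f : F -> F)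
    (s : seq F) :
  equivalence_rel r -> (forall x, #|r x| = m) ->
  {in s &, forall x y, r (f x) (f y) = r x y} ->
  #|[pred z | has (fun x => r (f x) z) s]| = #|[pred z | has (r^~ z) s]|.
Proof.
move=> eqr cardr.
have [r_refl r_left] := (equivalence_relP r).1 eqr.
have r_sym := equivalence_rel_sym _ _ eqr.
have card_cons (g : F -> F) x t :
    #|[pred z | has (fun y => r (g y) z) (x :: t)]| =
    (if has (fun y => r (g y) (g x)) t then 0 else m) +
      #|[pred z | has (fun y => r (g y) z) t]|.
  case: ifPn => [/hasP[y yt ryx]|/hasPn nt].
    rewrite add0n; apply: eq_card => z; rewrite !inE /=.
    apply/orb_idl => rxz; apply/hasP; exists y => //.
    by rewrite (r_left _ _ ryx).
  rewrite -(cardr (g x)) -cardUI [X in _ = _ + X]eq_card0 ?addn0.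
    by apply: eq_card => z; rewrite !inE.
  move=> z; rewrite !inE; apply/negP => /andP[rxz /hasP[y yt ryz]].
  by move/negP: (nt y yt); apply; rewrite (r_left _ _ ryz) r_sym.
elim: s => [_|x s IHs fP]; first exact: eq_card.
rewrite (card_cons f) (card_cons id) IHs.
  congr (((if _ then _ else _) + _)%N).
  by apply: eq_in_has => y ys; rewrite fP // !inE ?eqxx ?ys ?orbT.
by move=> y z ys zs; rewrite fP // inE ?ys ?zs orbT.
Qed.

(** * Chains of equivalence relations on a finite type *)

Section FiniteNested.

Variables (F : finType) (n : nat) (e : nat -> rel F).
Hypothesis e_equiv : forall k, equivalence_rel (e k).
Hypothesis e_nested : forall k x y, e k.+1 x y -> e k x y.
Hypothesis e_total : forall x y, e 0 x y.
Hypothesis e_discrete : forall x y, e n x y -> x = y.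
Hypothesis e_uniform : forall k x y, #|e k x| = #|e k y|.

Let e_refl k : reflexive (e k).
Proof. by case: ((equivalence_relP (e k)).1 (e_equiv k)). Qed.

Let e_left k : left_transitive (e k).
Proof. by case: ((equivalence_relP (e k)).1 (e_equiv k)). Qed.

Let e_sym k : symmetric (e k).
Proof. exact: equivalence_rel_sym. Qed.

Let e_le j k x y : j <= k -> e k x y -> e j x y.
Proof.
elim: k => [|k IHk]; first by rewrite leqn0 => /eqP ->.
by rewrite leq_eqVlt ltnS => /predU1P[-> //|jk] /e_nested; apply: IHk.
Qed.

(** If every candidate image were excluded by the image of [s], the
[e k.+1]-classes meeting [s] would fill a whole [e k]-class, although the
class of [x] among them is missing. *)
Lemma one_point_extension (s : seq F) (f : F -> F) (x : F) :
  x \notin s ->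
  (forall k, {in s &, forall a b, e k (f a) (f b) = e k a b}) ->
  exists y, forall k, {in s, forall a, e k (f a) y = e k a x}.
Proof.
move=> xNs fP.
(* [k.+1] is the coarsest level at which [x] is unrelated to all of [s]. *)
have /ex_minnP[[|k] kN kmin] : exists k, ~~ has (e k x) s.
- exists n; apply/hasPn => a sa; apply: contra xNs => /e_discrete ->.
  exact: sa.
- (* Level [0] is total, so here [s] is empty. *)
  exists x => k a sa; move/hasPn: kN => /(_ a sa).
  by rewrite e_total.
have /hasP[a0 sa0 xa0] : has (e k x) s.
  by apply/negPn/negP => /kmin; rewrite ltnn.
(* The points [a] of [s] outside [t] exclude nothing: their images are not even
   [e k]-related to [f a0]. *)
pose t := [seq a <- s | e k x a].
have [y ya0 yN] : exists2 y, e k (f a0) y & ~~ has (fun a => e k.+1 (f a) y) t.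
  have : ~~ (e k (f a0) \subset [pred y | has (fun a => e k.+1 (f a) y) t]).
    apply/negP => /subset_leq_card; apply/negP; rewrite -ltnNge.
    rewrite (@card_classes_meeting F (e k.+1) #|e k.+1 x|) //.
    - rewrite (e_uniform k (f a0) x); apply/proper_card/properP; split.
        apply/fintype.subsetP => z; rewrite !inE => /hasP[a].
        rewrite mem_filter => /andP[xa _] /e_nested az.
        by rewrite unfold_in (e_left _ _ _ xa).
      exists x; rewrite ?unfold_in ?e_refl //=; apply: contra kN.
      case/hasP => a; rewrite mem_filter => /andP[_ sa] ax.
      by apply/hasP; exists a; rewrite // e_sym.
    - by move=> a b; rewrite !mem_filter => /andP[_ sa] /andP[_ sb]; exact: fP.
  by case/subsetPn => y; rewrite !inE => ? ?; exists y.
exists y => j a sa.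
have [jk|kj] := leqP j k.
  have j0 := e_le _ _ _ _ jk ya0; have jx := e_le _ _ _ _ jk xa0.
  by rewrite e_sym -(e_left _ _ _ j0) fP // -(e_left _ _ _ jx) e_sym.
have -> : e j a x = false.
  apply/negP => /(e_le _ _ _ _ kj); rewrite e_sym => ax.
  by move/hasPn/(_ a sa)/negP: kN; apply.
apply/negP => /(e_le _ _ _ _ kj) ay.
move/negP: yN; apply; apply/hasP; exists a => //.
rewrite mem_filter sa andbT (e_left _ _ _ xa0) -fP // (e_left _ _ _ ya0) e_sym.
exact: e_nested.
Qed.

Lemma finite_extension (s : seq F) (f : F -> F) :
  (forall k, {in s &, forall a b, e k (f a) (f b) = e k a b}) ->
  exists2 p : F -> F, injective p &
    {in s, p =1 f} /\ forall k x y, e k (p x) (p y) = e k x y.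
Proof.
move=> fP.
suff [p pf pP] : exists2 p : F -> F, {in s, p =1 f} &
    forall k, {in enum F ++ s &, forall a b, e k (p a) (p b) = e k a b}.
  have pP' k x y : e k (p x) (p y) = e k x y.
    by apply: pP; rewrite mem_cat mem_enum.
  exists p => // x y pxy; apply: e_discrete.
  by rewrite -pP' pxy e_refl.
elim: (enum F) => [|x t [p pf pP]]; first by exists f.
have [xt|xNt] := boolP (x \in t ++ s).
  exists p => // k a b; rewrite !inE.
  by move=> /predU1P[->|at_] /predU1P[->|bt]; apply: pP.
have [y yP] := one_point_extension _ _ _ xNt pP.
have neq a : a \in t ++ s -> a == x = false.
  by move=> ta; apply: contraNF xNt => /eqP <-.
exists (fun z => if z == x then y else p z) => [a sa|k a b].
  by rewrite neq ?pf // mem_cat sa orbT.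
rewrite !inE => /predU1P[->|ta] /predU1P[->|tb]; rewrite ?eqxx ?neq ?e_refl //.
- by rewrite e_sym yP // e_sym.
- exact: yP.
- exact: pP.
Qed.

End FiniteNested.

(** * From a nested structure to a finite chain *)

Lemma erel_refl (n : nat) (A : eqStructure n) (i : 'I_n) (x : A) : erel i x x.
Proof. by have [r _ _] := erel_equiv A i; exact: r. Qed.

Lemma erel_sym (n : nat) (A : eqStructure n) (i : 'I_n) (x y : A) :
  erel i x y -> erel i y x.
Proof. by have [_ s _] := erel_equiv A i; exact: s. Qed.

Lemma erel_trans (n : nat) (A : eqStructure n) (i : 'I_n) (x y z : A) :
  erel i x y -> erel i y z -> erel i x z.
Proof. by have [_ _ t] := erel_equiv A i; exact: t. Qed.

Lemma nested_le (n : nat) (A : eqStructure n) (i j : 'I_n) (x y : A) :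
  nested A -> i <= j -> erel j x y -> erel i x y.
Proof.
move=> nA; rewrite leq_eqVlt => /predU1P[/val_inj -> //|ij].
exact: (nA _ _ ij).
Qed.

(** The coarsest classes that meet [S] would do for [U]; taking the classes of
all the relations, together with [S] itself, also covers [n = 0]. *)
Lemma finite_saturation (n : nat) (A : eqStructure n) (S : set A) :
  nested A -> (forall (i : 'I_n) (x : A), finite_set (eclass i x)) ->
  finite_set S ->
  exists U : set A, [/\ finite_set U, S `<=` U &
    forall (i : 'I_n) (x y : A), U x -> erel i x y -> U y].
Proof.
move=> nA finA finS.
exists (S `|` \bigcup_(i in [set: 'I_n]) \bigcup_(x in S) eclass i x).
split=> [|x Sx|i x y]; last 2 first.
- by left.
- case=> [Sx xy|[j _ [z Sz zx]] xy]; right; first by exists i => //; exists x.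
  have [ij|/ltnW ji] := leqP i j.
    exists i => //; exists z => //; apply: erel_trans xy.
    exact: nested_le zx.
  exists j => //; exists z => //; apply: erel_trans zx _.
  exact: nested_le xy.
rewrite finite_setU; split=> //; apply: bigcup_finite => // i _.
exact: bigcup_finite.
Qed.

(** An injection [h] from ['I_N] with saturated image stands for a finite union
of classes.  Pulling the relations back along [h] gives the chain to which
[finite_extension] applies; saturation makes the pulled-back classes as large
as the original ones. *)
Lemma saturated_extension (n : nat) (A : eqStructure n) (N : nat)
    (h : 'I_N -> A) (s : seq 'I_N) (f : 'I_N -> 'I_N) :
  nested A ->
  (forall (i : 'I_n) (x y : A), (eclass i x #= eclass i y)%card) ->
  injective h ->
  (forall (i : 'I_n) a (y : A), erel i (h a) y -> exists b, h b = y) ->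
  {in s &, injective f} ->
  (forall i : 'I_n,
    {in s &, forall a b, erel i (h (f a)) (h (f b)) <-> erel i (h a) (h b)}) ->
  exists2 p : 'I_N -> 'I_N, injective p & {in s, p =1 f} /\
    forall (i : 'I_n) a b, erel i (h (p a)) (h (p b)) <-> erel i (h a) (h b).
Proof.
move=> nA unifA hinj hsat finj fE.
(* The indices are shifted by one: level [0] is total, and every level above
   [n] is equality. *)
pose e k : rel 'I_N := fun a b =>
  if k is k'.+1 then
    if insub k' : option 'I_n is Some i then `[< erel i (h a) (h b) >]
    else a == b
  else true.
have eE (i : 'I_n) a b : e i.+1 a b = `[< erel i (h a) (h b) >].
  by rewrite /e /= valK.
have e_out k a b : n <= k -> e k.+1 a b = (a == b).
  by move=> nk; rewrite /e /= insubN // -leqNgt.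
have e0 a b : e 0 a b by [].
clearbody e.
have e_ind (P : nat -> Prop) : P 0 -> (forall i : 'I_n, P i.+1) ->
    (forall k, n <= k -> P k.+1) -> forall k, P k.
  move=> P0 Pi Pk [//|k]; have [|kn] := leqP n k; first exact: Pk.
  exact: (Pi (Ordinal kn)).
have e_equiv k : equivalence_rel (e k).
  apply/equivalence_relP; elim/e_ind: k => [|i|k nk]; split.
  - by move=> a; exact: e0.
  - by move=> a b _ c; rewrite !e0.
  - by move=> a; rewrite eE; apply/asboolP; exact: erel_refl.
  - move=> a b; rewrite eE => /asboolP ab c; rewrite !eE.
    apply: asbool_equiv_eq; split; first exact/erel_trans/erel_sym.
    exact: erel_trans.
  - by move=> a; rewrite e_out.
  - by move=> a b; rewrite e_out // => /eqP ->.
have e_nested k a b : e k.+1 a b -> e k a b.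
  elim/e_ind: k => [//|i|k nk]; last by rewrite !e_out // ltnW.
  have [ni|iN] := leqP n i.+1.
    rewrite e_out // => /eqP ->; rewrite eE; apply/asboolP.
    exact: erel_refl.
  rewrite (eE (Ordinal iN)) eE => /asboolP abi.
  by apply/asboolP; exact: (nA _ (Ordinal iN) _ _ _ abi).
have e_discrete a b : e n.+1 a b -> a = b by rewrite e_out // => /eqP.
have e_uniform k a b : #|e k a| = #|e k b|.
  elim/e_ind: k => [|i|k nk].
  - by apply: eq_card => c; rewrite !unfold_in !e0.
  - apply: card_eq_pred.
    have img c : eclass i (h c) = h @` [set` e i.+1 c].
      apply/seteqP; split=> [z cz|_ [d + <-]]; last first.
        by rewrite /= unfold_in eE => /asboolP.
      have [d dz] := hsat _ _ _ cz.
      by exists d => //=; rewrite unfold_in eE dz; apply/asboolP.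
    have himg (X : set 'I_N) : (h @` X #= X)%card.
      by apply: inj_card_eq; apply: in2W.
    have := unifA i (h a) (h b); rewrite !img.
    by rewrite (card_eql (himg _)) (card_eqr (himg _)).
  - have card1_class c : #|e k.+1 c| = 1.
      rewrite -(card1 c); apply: eq_card => z.
      by rewrite unfold_in e_out // eq_sym.
    by rewrite !card1_class.
have efE k : {in s &, forall a b, e k (f a) (f b) = e k a b}.
  move=> a b sa sb; elim/e_ind: k => [|i|k nk]; first by rewrite !e0.
    by rewrite !eE; apply: asbool_equiv_eq; exact: fE.
  by rewrite !e_out //; apply/eqP/eqP => [/finj|->] //; exact.
have [p pinj [pf pE]] := finite_extension _ _ e e_equiv e_nested e0
  e_discrete e_uniform s f efE.
exists p => //; split=> // i a b.
by apply: asbool_eq_equiv; rewrite -!eE.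
Qed.

(** No relation crosses the boundary of a saturated set, so a permutation of it
that preserves the relations can be glued with the identity outside. *)
Lemma saturated_automorphism (n : nat) (A : eqStructure n) (N : nat)
    (h : 'I_N -> A) (p : 'I_N -> 'I_N) :
  injective h ->
  (forall (i : 'I_n) a (y : A), erel i (h a) y -> exists b, h b = y) ->
  injective p ->
  (forall (i : 'I_n) a b, erel i (h (p a)) (h (p b)) <-> erel i (h a) (h b)) ->
  exists2 g : A -> A, automorphism g & forall a, g (h a) = h (p a).
Proof.
move=> hinj hsat pinj pE.
have [q qp pq] := injF_bij pinj.
pose U x := exists a, h a = x.
have glue (r : 'I_N -> 'I_N) : exists g : A -> A,
    (forall a, g (h a) = h (r a)) /\ (forall x, ~ U x -> g x = x).
  suff /choice[g gP] : forall x, exists y,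
      (forall a, h a = x -> y = h (r a)) /\ (~ U x -> y = x).
    exists g; split=> [a|x]; first exact: (gP _).1.
    exact: (gP _).2.
  move=> x; have [[a ax]|nUx] := pselect (U x).
    exists (h (r a)); split=> [b|]; last by case; exists a.
    by rewrite -ax => /hinj ->.
  by exists x; split=> // a ax; case: nUx; exists a.
have [g [gh gid]] := glue p; have [g' [g'h g'id]] := glue q.
exists g => //; split.
  exists g' => x; have [[a <-]|nUx] := pselect (U x).
  - by rewrite gh g'h qp.
  - by rewrite gid // g'id.
  - by rewrite g'h gh pq.
  - by rewrite g'id // gid.
have gU x : U (g x) <-> U x.
  have [[a <-]|nUx] := pselect (U x); last by rewrite gid.
  by rewrite gh; split=> _; [exists a | exists (p a)].
have Ucl (i : 'I_n) (x y : A) : U x -> erel i x y -> U y.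
  by move=> [a <-]; exact: hsat.
have Ucl' (i : 'I_n) (x y : A) : U y -> erel i x y -> U x.
  by move=> Uy /erel_sym; exact: Ucl.
move=> i x y; have [Ux|nUx] := pselect (U x); have [Uy|nUy] := pselect (U y).
- move: Ux Uy => [a <-] [b <-]; rewrite !gh.
  by split=> /pE.
- by split=> [/(Ucl i _ _ Ux)//|/Ucl]; rewrite !gU => /(_ Ux).
- by split=> [/(Ucl' i _ _ Uy)//|/Ucl']; rewrite !gU => /(_ Uy).
- by rewrite !gid.
Qed.

(** * Uniformity and ultrahomogeneity *)

Lemma ultrahomogeneous_card_eclass (n : nat) (A : eqStructure n) :
  ultrahomogeneous A ->
  forall (i : 'I_n) (x y : A), (eclass i x #= eclass i y)%card.
Proof.
move=> uA i x y.
have y_in : y \in [set y] by rewrite inE.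
pose f (_ : induced [set x]) : induced [set y] := SigSub y_in.
have sub1 (z : A) (a : induced [set z]) : val a = z := set_valP a.
have [|g [[g' gK g'K] gE] gf] := uA _ _ (finite_set1 x) (finite_set1 y) f.
  split.
    have x_in : x \in [set x] by rewrite inE.
    by exists (fun=> SigSub x_in) => a; apply: val_inj; rewrite /= sub1.
  move=> j a b /=; rewrite !sub1.
  by have [r _ _] := erel_equiv A j; split=> _; apply: r.
have gx : g x = y by have /= := gf (SigSub (mem_set (erefl x))).
have -> : eclass i y = g @` eclass i x.
  apply/seteqP; split=> [z yz|_ [z xz <-]]; rewrite /eclass /=.
    by exists (g' z) => //; apply: (gE _ _ _).2; rewrite g'K gx.
  by rewrite -gx; apply: (gE _ _ _).1.
by apply/card_esym/inj_card_eq; apply: in2W; apply: can_inj gK.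
Qed.

Lemma uniform_ultrahomogeneous (n : nat) (A : eqStructure n) :
  nested A ->
  (forall (i : 'I_n) (x : A), finite_set (eclass i x)) ->
  (forall (i : 'I_n) (x y : A), (eclass i x #= eclass i y)%card) ->
  ultrahomogeneous A.
Proof.
move=> nA finA unifA S T finS finT f [[f' fK f'K] fE].
have finST : finite_set (S `|` T) by rewrite finite_setU.
have [U [finU STU Ucl]] := finite_saturation _ _ _ nA finA finST.
have [N [h [hinj hU]]] := finite_set_enum _ _ finU.
have hsat (i : 'I_n) a (y : A) : erel i (h a) y -> exists b, h b = y.
  by move=> ay; apply/hU; apply: Ucl ay; apply/hU; exists a.
(* [f0] is [f] read on indices, with arbitrary values outside [S]. *)
have /choice[f0 f0P] : forall a, exists b, forall x : S,
    val x = h a -> h b = val (f x).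
  move=> a; have [Sa|nSa] := pselect (S (h a)); last first.
    by exists a => x xa; case: nSa; rewrite -xa; exact: set_valP x.
  have /hU[b bE] : U (val (f (SigSub (mem_set Sa)))).
    by apply: STU; right; exact: set_valP.
  by exists b => x xa; rewrite bE; congr (val (f _)); apply: val_inj.
pose s := [seq a <- enum 'I_N | `[< S (h a) >]].
have sP a : a \in s -> exists2 x : S, h a = val x & h (f0 a) = val (f x).
  rewrite mem_filter => /andP[/asboolP Sa _].
  by exists (SigSub (mem_set Sa)) => //; exact: f0P.
have f0inj : {in s &, injective f0}.
  move=> a b /sP[x ax fx] /sP[y by_ fy] fab; apply: hinj.
  move: fx; rewrite fab fy => /val_inj/(can_inj fK) yx.
  by rewrite ax by_ yx.
have f0E (i : 'I_n) : {in s &, forall a b,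
    erel i (h (f0 a)) (h (f0 b)) <-> erel i (h a) (h b)}.
  move=> a b /sP[x -> ->] /sP[y -> ->].
  by apply: iff_sym; exact: (fE i x y).
have [p pinj [pf pE]] :=
  saturated_extension _ _ _ _ _ _ nA unifA hinj hsat f0inj f0E.
have [g gaut gh] := saturated_automorphism _ _ _ _ _ hinj hsat pinj pE.
exists g => // x.
have /hU[a ax] : U (val x) by apply: STU; left; exact: set_valP x.
have sa : a \in s.
  rewrite mem_filter mem_enum andbT; apply/asboolP; rewrite ax.
  exact: set_valP x.
by rewrite -ax gh pf //; exact: f0P.
Qed.

Theorem corollary8p5 (n : nat) (A : eqStructure n)
    (countableA : countable [set: A])
    (nestedA : nested A)
    (finite_classes : forall (i : 'I_n) (x : A), finite_set (eclass i x)) :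
  ultrahomogeneous A <-> forall i : 'I_n, ultrahomogeneous (reduct A i).
Proof.
split=> [uA i|uA].
  apply: uniform_ultrahomogeneous => [j k|j x|j x y].
  - by rewrite !ord1.
  - exact: finite_classes.
  - exact: (ultrahomogeneous_card_eclass _ _ uA i x y).
apply: uniform_ultrahomogeneous => // i x y.
exact: (ultrahomogeneous_card_eclass _ _ (uA i) ord0 x y).
Qed.
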